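(* Let $t\le L\le s\le m$ and $q\ge2$ be positive integers, and suppose there exist a $t$-$(m,q,L,1)$ GDD and an $\mathrm{OA}(m,q,s)$. Then there exists a $(K,F,Z,S)$ PDA with $$K=\frac{\binom{m}{t}q^t}{\binom{L}{t}},\quad F=q^s\binom{L}{t},\quad Z=\left(q^s-(q-1)^Lq^{s-L}\right)\binom{L}{t},\quad S\le(q-1)^tq^m.$$ Consequently, for the shared-link coded caching model with $K$ users and $N$ files, the memory-load point $$(M,R)=\left(N-\frac{(q-1)^LN}{q^L},\ \frac{(q-1)^tq^{m-s}}{\binom{L}{t}}\right)$$ is achievable with subpacketization $F=q^s\binom{L}{t}$. In addition, in the following cases there is such a PDA (with the same $K,F,Z$) for which the value of $S$, and the load $R=S/F$ of the resulting shared-link scheme with the same $M$ and $F$, are as follows: (i) if $L=t$ and $s=m-1$, then $S=(q-1)^tq^{m-1}$ and $R=(q-1)^t$; (ii) if $L=t$ and $s+t=m$ with $s>t$, then $S=(q^t-1)q^{m-t}$ and $R=q^t-1$; (iii) if $s=m$, then $S\le(q-1)^tq^m$ and $R\le(q-1)^t/\binom{L}{t}$.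
   Context: Notation: $[n]=\{1,\dots,n\}$. Group divisible design. For positive integers $t\le L\le m$ and $q$, a $t$-$(m,q,L,\lambda)$ GDD is a triple $(\mathcal{X},\mathfrak{G},\mathfrak{B})$ where $\mathcal{X}$ is a set of $mq$ points; $\mathfrak{G}=\{\mathcal{G}_1,\dots,\mathcal{G}_m\}$ is a partition of $\mathcal{X}$ into $m$ subsets (groups) of size $q$; and $\mathfrak{B}$ is a family of $L$-subsets of $\mathcal{X}$ (blocks) such that every block meets every group in at most one point, and every $t$-subset of points from $t$ distinct groups is contained in exactly $\lambda$ blocks. Orthogonal array. For $q\ge2$ and $s\le m$, an $\mathrm{OA}_\lambda(m,q,s)$ is a $\lambda q^s\times m$ matrix with entries in $[q]$ such that, in every choice of $s$ columns, each vector of $[q]^s$ appears as a row exactly $\lambda$ times; $\mathrm{OA}(m,q,s)$ means $\lambda=1$. A $(K,F,Z,S)$ placement delivery array (PDA) is an $F\times K$ array $\mathbf{P}$ with entries in $\{*\}\cup[S]$ such that: (C1) the symbol $*$ appears exactly $Z$ times in each column; (C2) each integer of $[S]$ occurs at least once; (C3) whenever two distinct entries satisfy $\mathbf{P}(j_1,k_1)=\mathbf{P}(j_2,k_2)=a\in[S]$, then $j_1\ne j_2$, $k_1\ne k_2$, and $\mathbf{P}(j_1,k_2)=\mathbf{P}(j_2,k_1)=*$. Shared-link coded caching model. A server with $N$ equal-length files is connected by an error-free shared link to $K\le N$ users, each having its own cache of size $M$ files. An $F$-division scheme (subpacketization $F$): each file is divided into $F$ packets of equal size; in the placement phase each user caches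 at most $MF$ packets without knowledge of later requests; in the delivery phase, given the request vector $\mathbf{d}\in[N]^K$, the server broadcasts $S_{\mathbf{d}}$ coded packets so that every user recovers its requested file from its cache and the broadcast. The load is $\max_{\mathbf{d}\in[N]^K}S_{\mathbf{d}}/F$. A point $(M,R)$ is achievable with subpacketization $F$ if there is an $F$-division scheme with cache size $M$ and load at most $R$. *)

(* Defs.v *)
From mathcomp Require Import all_boot all_order all_algebra.

Set Implicit Arguments.
Unset Strict Implicit.
Unset Printing Implicit Defensive.

Import Order.TTheory GRing.Theory Num.Theory.

(* The index sets [n] = {1, ..., n} are rendered as 'I_n = {0, ..., n - 1}. *)

(* The block family is a sequence, so that repeated blocks are allowed and
   counted with multiplicity. *)
Record is_gdd (t m q L lam : nat) (X : finType)
    (G : {set {set X}}) (B : seq {set X}) : Prop := IsGDD {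
  gdd_points : #|X| = m * q;
  gdd_partition : partition G [set: X];
  gdd_ngroups : #|G| = m;
  gdd_group_size : forall g, g \in G -> #|g| = q;
  gdd_block_size : forall b, b \in B -> #|b| = L;
  gdd_block_group : forall b g, b \in B -> g \in G -> #|b :&: g| <= 1;
  gdd_cover : forall T : {set X}, #|T| = t ->
    (forall g, g \in G -> #|T :&: g| <= 1) ->
    count (fun b : {set X} => T \subset b) B = lam
}.

Definition is_oa (lam m q s : nat) (A : 'M['I_q]_(lam * q ^ s, m)) : Prop :=
  forall (c : 'I_s -> 'I_m) (v : {ffun 'I_s -> 'I_q}), injective c ->
    #|[set r | [forall i, A r (c i) == v i]]| = lam.

(* [None] is the symbol *. *)
Record is_pda (K F Z S : nat) (P : 'M[option 'I_S]_(F, K)) : Prop := IsPDA {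
  pda_C1 : forall k, #|[set j | P j k == None]| = Z;
  pda_C2 : forall a : 'I_S, exists j k, P j k = Some a;
  pda_C3 : forall (a : 'I_S) j1 k1 j2 k2, (j1, k1) != (j2, k2) ->
    P j1 k1 = Some a -> P j2 k2 = Some a ->
    [/\ j1 != j2, k1 != k2, P j1 k2 = None & P j2 k1 = None]
}.

(* A packet consists of [l] bits, so that a file consists of [F * l] bits. *)
Definition packet (l : nat) := 'rV['F_2]_l.

(* [W (n, j)] is the [j]-th packet of the [n]-th file. *)
Definition library (N F l : nat) := {ffun 'I_N * 'I_F -> packet l}.

Definition request (N K : nat) := {ffun 'I_K -> 'I_N}.

Definition cached (N F l : nat) (C : {set 'I_N * 'I_F}) (W : library N F l) :
    {ffun 'I_N * 'I_F -> option (packet l)} :=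
  [ffun p => if p \in C then Some (W p) else None].

(* Placement chooses packets of the files and does not depend on the request.
   The coded packets may be arbitrary functions of the library, and each user
   knows the request vector, its cache content and the broadcast. *)
Record scheme (N K F l : nat) := Scheme {
  cache : 'I_K -> {set 'I_N * 'I_F};
  nsent : request N K -> nat;
  encode : forall d : request N K,
    library N F l -> (nsent d).-tuple (packet l);
  decode : forall d : request N K, 'I_K ->
    {ffun 'I_N * 'I_F -> option (packet l)} -> (nsent d).-tuple (packet l) ->
    'I_F -> packet l;
  decode_correct : forall (d : request N K) (W : library N F l) (k : 'I_K)
    (j : 'I_F),
    decode k (cached (cache k) W) (encode d W) j = W (d k, j)
}.

Definition load (N K F l : nat) (sch : scheme N K F l) : rat :=
  ((\max_(d : request N K) nsent sch d)%N%:R / F%:R)%R.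

Definition cache_size_le (N K F l : nat) (M : rat)
    (sch : scheme N K F l) : Prop :=
  forall k, (#|cache sch k|%:R <= M * F%:R)%R.

(* Schemes are required for every packet length [l]; allowing a single one
   would make the notion trivial, by taking [l = 0]. *)
Definition achievable (N K F : nat) (M R : rat) : Prop :=
  forall l, exists sch : scheme N K F l,
    cache_size_le M sch /\ (load sch <= R)%R.

(* The scheme resulting from an array [P]: user [k] caches the [j]-th packet of
   every file when [P j k] is *, and for each [a] in [S] the server sends the
   sum (XOR) of the [j]-th packets of the files requested by the users [k],
   over all [(j, k)] with [P j k = a]. *)
Definition pda_packet (N K F S l : nat) (P : 'M[option 'I_S]_(F, K))
    (d : request N K) (W : library N F l) (a : 'I_S) : packet l :=
  (\sum_(x : 'I_F * 'I_K | P x.1 x.2 == Some a) W (d x.2, x.1))%R.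

Definition results_from (N K F S l : nat) (P : 'M[option 'I_S]_(F, K))
    (sch : scheme N K F l) : Prop :=
  (forall k, cache sch k = [set p | P p.2 k == None]) /\
  (forall d W, encode sch d W = [seq pda_packet P d W a | a <- enum 'I_S]
    :> seq (packet l)).

(* The scheme resulting from [P] exists, with cache size [M] and load [S / F],
   for all numbers of files [N >= K] and all packet lengths. *)
Definition pda_scheme (K F S : nat) (P : 'M[option 'I_S]_(F, K))
    (M : nat -> rat) : Prop :=
  forall N l, K <= N -> exists sch : scheme N K F l,
    [/\ results_from P sch, cache_size_le (M N) sch
      & load sch = (S%:R / F%:R)%R].

(* Main.v *)
(* Rows of the array are pairs of a codeword f of the orthogonal array and a
   t-subset of the L points of a block; columns are the blocks.  The entry is *
   when f passes through a point of the block; otherwise overwrite f on the t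
   chosen groups by the block, giving e, and take (differences, e) as symbol,
   where the differences between f and the block on the t chosen groups allow f
   to be recovered.  There are at most (q-1)^t q^m symbols.  Two entries with the
   same e and the same t groups lie in the same block, as lambda = 1; with
   different t groups, each row meets the block of the other entry.

   For (i) the orthogonal array is replaced by the words in (Z/q)^m with zero
   sum: the attained symbols are then exactly those whose differences are nowhere
   zero and cancel the sum of e.  For (ii) the codeword is already determined by
   its m - t = s unchanged coordinates, so e alone serves as the symbol; the
   attained e are exactly the non-codewords. *)
Require Import Defs.
From mathcomp Require Import all_boot all_order all_algebra.
From mathcomp Require Import zify ring.

Set Implicit Arguments.
Unset Strict Implicit.
Unset Printing Implicit Defensive.

Import Order.TTheory GRing.Theory Num.Theory.

(** * PDAs from arrays of symbols, and caching schemes from PDAs *)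

Definition attained (J C Sig : finType) (p : J -> C -> option Sig) :=
  [set a | [exists j, exists c, p j c == Some a]].

Lemma attainedP (J C Sig : finType) (p : J -> C -> option Sig) a :
  reflect (exists j c, p j c = Some a) (a \in attained p).
Proof.
rewrite inE; apply: (iffP existsP) => [[j /existsP[c /eqP jc]]|[j [c jc]]].
  by exists j, c.
by exists j; apply/existsP; exists c; apply/eqP.
Qed.

(** Keeping only the attained symbols, renumbered by [ren], gives (C2). For (C3) one starred cell
    suffices: exchanging the two entries stars the other cell, and equal rows or equal columns would
    put the common symbol into a starred cell. *)
Lemma pda_of_array (J C Sig : finType) (p : J -> C -> option Sig) (K F Z : nat) :
  #|J| = F -> #|C| = K ->
  (forall c, #|[set j | p j c == None]| = Z) ->
  (forall a j1 c1 j2 c2, p j1 c1 = Some a -> p j2 c2 = Some a ->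
     (j1, c1) = (j2, c2) \/ p j1 c2 = None) ->
  exists P : 'M[option 'I_#|attained p|]_(F, K), is_pda Z P.
Proof.
move=> <- <- hZ h3; set A := attained p; set S := #|A|.
pose ren (x : option Sig) : option 'I_S :=
  obind (fun a => insub (index a (enum A))) x.
have ltA a : a \in A -> index a (enum A) < S.
  by move=> aA; rewrite /S cardE index_mem mem_enum.
have inA j c a : p j c = Some a -> a \in A by move=> jc; apply/attainedP; exists j, c.
have renE j c (i : 'I_S) :
    ren (p j c) = Some i -> exists2 a, p j c = Some a & index a (enum A) = i.
  case jc: (p j c) => [a|] //= ; case: insubP => // u _ eu [<-].
  by exists a.
have ren0 j c : (ren (p j c) == None) = (p j c == None).
  case jc: (p j c) => [a|] //=.
  by case: insubP => // /negP[]; apply/ltA/(inA j c).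
have h3' a j1 c1 j2 c2 : (j1, c1) != (j2, c2) ->
    ren (p j1 c1) = Some a -> ren (p j2 c2) = Some a ->
    [/\ j1 != j2, c1 != c2, ren (p j1 c2) = None & ren (p j2 c1) = None].
  move=> ne /renE[a1 p1 e1] /renE[a2 p2 e2].
  have ea: a1 = a2.
    apply: (@index_inj _ a1 (enum A)); rewrite ?mem_enum ?e1 ?e2 //.
      exact: inA p1.
    exact: inA p2.
  rewrite -{a2 e2}ea in p2.
  have n12: p j1 c2 = None by case: (h3 _ _ _ _ _ p1 p2) => // e; rewrite e eqxx in ne.
  have n21: p j2 c1 = None.
    by case: (h3 _ _ _ _ _ p2 p1) => // e; rewrite e eqxx in ne.
  split; try by rewrite ?n12 ?n21.
    by apply/eqP => e; rewrite e p2 in n12.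
  by apply/eqP => e; rewrite -e p1 in n12.
exists (\matrix_(j, k) ren (p (enum_val j) (enum_val k)))%R; split.
- move=> k; rewrite -(hZ (enum_val k)) -(card_imset _ enum_val_inj).
  apply: eq_card => j; rewrite inE; apply/imsetP/idP.
    by case=> i; rewrite inE mxE ren0 => ? ->.
  by move=> pj; exists (enum_rank j); rewrite ?inE ?mxE ?ren0 enum_rankK.
- move=> a; have /attainedP[j [c jc]] := enum_valP a.
  exists (enum_rank j), (enum_rank c); rewrite mxE !enum_rankK jc /=.
  rewrite insubT ?ltA ?enum_valP // => lt; congr Some; apply: val_inj => /=.
  by rewrite /enum_val index_uniq ?enum_uniq -?cardE.
- move=> a j1 k1 j2 k2 ne; rewrite !mxE => e1 e2.
  rewrite -(inj_eq (@enum_val_inj _ _)) -(inj_eq (@enum_val_inj _ _) k1).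
  apply: (h3' a) => //; apply: contra_neq ne => -[e e'].
  by rewrite (enum_val_inj e) (enum_val_inj e').
Qed.

(** User [k] subtracts from the packet of symbol [a] every summand but its own; by (C3) these all
    lie in its cache. *)
Lemma pda_scheme_exists (N K F l Z S : nat) (P : 'M[option 'I_S]_(F, K)) :
  is_pda Z P -> K <= N -> exists sch : scheme N K F l,
    [/\ results_from P sch, forall k, #|cache sch k| = N * Z
      & load sch = (S%:R / F%:R)%R].
Proof.
move=> hP hKN.
pose ca (k : 'I_K) : {set 'I_N * 'I_F} := [set p | P p.2 k == None].
pose enc d (W : library N F l) := [tuple pda_packet P d W a | a < S].
pose c0 (Y : {ffun 'I_N * 'I_F -> option (packet l)}) p : packet l :=
  odflt 0%R (Y p).
pose dec (d : request N K) (k : 'I_K) Y (y : S.-tuple (packet l)) j : packet l :=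
  if P j k is Some a then
    (tnth y a - \sum_(x : 'I_F * 'I_K | (P x.1 x.2 == Some a) && (x != (j, k)))
      c0 Y (d x.2, x.1))%R
  else c0 Y (d k, j).
have decP d W k j : dec d k (cached (ca k) W) (enc d W) j = W (d k, j).
  rewrite /dec; case jk: (P j k) => [a|]; last first.
    by rewrite /c0 ffunE inE /= jk eqxx.
  rewrite tnth_mktuple /pda_packet (bigD1 (j, k)) /= ?jk //.
  rewrite [X in (_ - X)%R](_ : _ =
    \sum_(x | (P x.1 x.2 == Some a) && (x != (j, k))) W (d x.2, x.1))%R ?addrK //.
  apply: eq_bigr => -[j' k'] /andP[/eqP /= jk' ne].
  have [_ _ h _] := pda_C3 hP ne jk' jk.
  by rewrite /c0 ffunE inE /= h eqxx.
exists (@Scheme N K F l ca (fun=> S) enc dec decP); split=> //.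
  move=> k /=; rewrite -(pda_C1 hP k) -[X in _ = X * _]card_ord -cardsT -cardsX.
  by apply: eq_card => p; rewrite !inE.
rewrite /load /=; congr (_%:R / _)%R; apply/eqP; rewrite eqn_leq.
apply/andP; split; first by apply/bigmax_leqP.
(* [K <= N] provides a request vector, so the maximum is not taken over an empty set. *)
exact: (leq_bigmax (F := fun=> S) [ffun k => widen_ord hKN k]).
Qed.

(** * Set systems with exactly one member inside every t-set *)

Lemma superset_of_card (T : finType) (U : {set T}) (s : nat) :
  #|U| <= s -> s <= #|T| -> exists2 D : {set T}, U \subset D & #|D| = s.
Proof.
move=> hU hs; elim: s hU hs => [|s IHs] hU hs.
  by exists U => //; apply/eqP; rewrite -leqn0.
move: hU; rewrite leq_eqVlt => /predU1P[<-|hU]; first by exists U.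
have [D UD cD] := IHs hU (ltnW hs).
have /card_gt0P[x] : 0 < #|~: D| by rewrite cardsCs setCK subn_gt0 cD.
rewrite inE => xD; exists (x |: D); last by rewrite cardsU1 xD cD.
exact: subset_trans UD (subsetUr _ _).
Qed.

(** An exchange argument. Let U be the member inside a t-set D0, with |U| < t, and fix u in U. If no
    member has size t, trading u for a point y outside D0 yields a member omitting some w of U - u,
    and w determines y. So at most |U| - 1 points lie outside D0, which is too few. *)
Lemma exists_member_of_card (T : finType) (t : nat) (H : {set {set T}}) :
  t.*2 <= #|T|.+1 -> set0 \notin H ->
  (forall D : {set T}, #|D| = t -> exists! U : {set T}, U \in H /\ U \subset D) ->
  exists2 U, U \in H & #|U| = t.
Proof.
move=> ht H0 hH.
have uniH (D V V' : {set T}) : #|D| = t -> V \in H -> V' \in H ->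
    V \subset D -> V' \subset D -> V = V'.
  move=> /hH[U [_ hU]] VH VH' VD VD'.
  by rewrite -(hU V) ?(hU V').
have [D0 _ cD0] : exists2 D0 : {set T}, set0 \subset D0 & #|D0| = t.
  by apply: superset_of_card; rewrite ?cards0 //; lia.
have [U [[UH UD0] _]] := hH _ cD0.
have [cU|cU] := eqVneq #|U| t; first by exists U.
have [/exists_inP[V VH /eqP cV]|/exists_inPn noH] :=
  boolP [exists V in H, #|V| == t]; first by exists V.
have [u uU] : exists u, u \in U.
  by apply/set0Pn; apply: contraNneq H0 => <-.
have uD0 := subsetP UD0 _ uU.
pose Q y w := [exists V in H,
  [&& V \subset y |: (D0 :\ u), w \notin V & y \in V]].
have cD0u : #|D0 :\ u| = t.-1 by rewrite -cD0 (cardsD1 u D0) uD0.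
have t0 : 0 < t by rewrite -cD0; apply/card_gt0P; exists u.
(* The member V inside D0 - u + y omits some w of U - u: if w lay outside U,
   then D0 + y - w would contain both U and V. *)
have exQ y : y \notin D0 -> exists2 w, w \in U :\ u & Q y w.
  move=> yD0; set D := y |: (D0 :\ u).
  have cD : #|D| = t.
    by rewrite cardsU1 cD0u !inE (negPf yD0) andbF /= add1n prednK.
  have uD : u \notin D by rewrite !inE eqxx orbF; apply: contraNneq yD0 => <-.
  have [V [[VH VD] _]] := hH _ cD.
  have neVU : V <> U by move=> e; move/subsetP/(_ u): VD; rewrite e (negPf uD) => /(_ uU).
  have yV : y \in V.
    apply/negPn/negP => yV; apply: neVU; apply: (uniH D0) => //.
    apply/subsetP => x xV; have := subsetP VD x xV; rewrite !inE.
    by case/predU1P => [ex|/andP[]//]; rewrite -ex xV in yV.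
  have /subsetPn[w wD wV] : ~~ (D \subset V).
    apply/negP => DV; have eV : D = V by apply/eqP; rewrite eqEsubset DV.
    by have := noH _ VH; rewrite -eV cD eqxx.
  have wy : w != y by apply: contraNneq wV => ->.
  have [wu wD0] : w != u /\ w \in D0.
    by move: wD; rewrite !inE (negPf wy) => /andP.
  exists w; last by apply/exists_inP; exists V; rewrite ?VD ?wV.
  rewrite !inE wu /=; apply/negPn/negP => wU; apply: neVU.
  apply: (uniH (y |: (D0 :\ w))) => //.
  - rewrite cardsU1 !inE (negPf yD0) andbF /= -cD0.
    by rewrite (cardsD1 w D0) wD0.
  - apply/subsetP => x xV; have := subsetP VD x xV; rewrite !inE.
    case/predU1P => [->|/andP[_ ->]]; first by rewrite eqxx.
    by rewrite andbT orbC; apply/orP; left; apply: contraNneq wV => <-.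
  - apply/subsetP => x xU; rewrite !inE (subsetP UD0 _ xU) andbT orbC.
    by apply/orP; left; apply: contraNneq wU => <-.
(* If y and y' share w, the t-set D0 - u - w + y + y' contains both members, so they coincide; but
   V' avoids y. *)
have injQ y y' w : y \notin D0 -> y' \notin D0 -> w \in U :\ u ->
    Q y w -> Q y' w -> y = y'.
  rewrite !inE => yD yD' /andP[wu wU] /exists_inP[V VH /and3P[VD wV yV]].
  move=> /exists_inP[V' VH' /and3P[VD' wV' yV']].
  apply/eqP/negPn/negP => ne.
  have e : V = V'.
    apply: (uniH (y |: (y' |: ((D0 :\ u) :\ w)))) => //.
    - rewrite !cardsU1 !inE (negPf ne) (negPf yD) (negPf yD') !andbF /=.
      have := cardsD1 w (D0 :\ u); rewrite !inE wu (subsetP UD0 _ wU) cD0u /=.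
      by rewrite !add1n => <-; rewrite prednK.
    - apply/subsetP => x xV; have := subsetP VD x xV; rewrite !inE.
      case/predU1P => [->|/andP[-> ->]]; first by rewrite eqxx.
      have -> : x != w by apply: contraNneq wV => <-.
      by rewrite !orbT.
    - apply/subsetP => x xV; have := subsetP VD' x xV; rewrite !inE.
      case/predU1P => [->|/andP[-> ->]]; first by rewrite eqxx orbT.
      have -> : x != w by apply: contraNneq wV' => <-.
      by rewrite !orbT.
  have := subsetP VD' y; rewrite -e yV !inE (negPf ne) (negPf yD) andbF.
  by move/(_ isT).
(* By [exQ] the default [u] is never reached for y outside D0. *)
pose g y := odflt u [pick w in U :\ u | Q y w].
have gP y : y \in ~: D0 -> g y \in U :\ u /\ Q y (g y).
  rewrite inE /g => /exQ[w wU Qw]; case: pickP => [x /andP[]//|/(_ w)].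
  by rewrite wU Qw.
(* With n = |T| this reads n - t <= |U| - 1 <= t - 2, against 2t <= n + 1. *)
have : #|~: D0| <= #|U :\ u|.
  rewrite -(card_in_imset (f := g)).
    by apply/subset_leq_card/subsetP => _ /imsetP[y /gP[h _] ->].
  move=> y y' yD yD' e; have [gU Qg] := gP y yD; have [_ Qg'] := gP y' yD'.
  by apply: (injQ y y' (g y)) => //; rewrite -?in_setC // e.
rewrite cardsCs setCK cD0.
have := cardsD1 u U; rewrite uU add1n.
have : #|U| < t by rewrite ltn_neqAle cU -cD0 subset_leq_card.
move: ht; move: #|U| #|U :\ u| #|T| => a b n; clear; lia.
Qed.

Lemma card_unique (T : finType) (A : {set T}) : (exists! x, x \in A) -> #|A| = 1.
Proof.
case=> x [xA hx]; apply/eqP/cards1P; exists x; apply/setP => y; rewrite inE.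
by apply/idP/eqP => [/hx|->].
Qed.

(** * Words, codes of given strength, and coverings by partial words *)

Section Words.

Variables m q : nat.
Local Notation word := {ffun 'I_m -> 'I_q.+1}.

Lemma card_words (F : 'I_m -> pred 'I_q.+1) :
  #|family F : pred word| = \prod_u #|F u|.
Proof. by rewrite card_family foldrE big_image. Qed.

Lemma prod_if_in (D : {set 'I_m}) (x y : nat) :
  \prod_u (if u \in D then x else y) = x ^ #|D| * y ^ (m - #|D|).
Proof.
rewrite (bigID (mem D)) /= (eq_bigr (fun=> x)) => [|u ->] //.
rewrite [X in _ * X](eq_bigr (fun=> y)) => [|u /negPf->] //.
rewrite !prod_nat_const; congr (_ * _ ^ _).
by rewrite -[X in X - _]card_ord -(cardC (mem D)) addKn.
Qed.

Lemma card_agree (D : {set 'I_m}) (v : word) :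
  #|[set w : word | [forall u in D, v u == w u]]| = q.+1 ^ (m - #|D|).
Proof.
rewrite -[RHS]mul1n -[X in X * _](exp1n #|D|) -prod_if_in.
transitivity #|family (fun u => if u \in D then pred1 (v u) else predT) : pred word|.
  apply: eq_card => w; rewrite inE; apply/forall_inP/familyP => h u.
    by case: ifP => // /h; rewrite inE eq_sym.
  by move=> uD; have := h u; rewrite uD inE eq_sym.
rewrite card_words; apply: eq_bigr => u _.
by case: ifP => _; rewrite ?card1 // cardT size_enum_ord.
Qed.

(* An orthogonal array of index 1 and strength s, with rows indexed by R. *)
Definition strength (s : nat) (R : finType) (w : R -> word) :=
  forall (D : {set 'I_m}) (v : word), #|D| = s -> exists! r, {in D, w r =1 v}.

Section Code.

Variables (s : nat) (R : finType) (w : R -> word).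
Hypotheses (hsm : s <= m) (hw : strength s w).

Lemma strength_eq (D : {set 'I_m}) r r' :
  #|D| = s -> {in D, w r =1 w r'} -> r = r'.
Proof.
by move=> cD e; have [r0 [_ h]] := hw (w r') cD; rewrite -(h r) ?(h r').
Qed.

Lemma strength_inj : injective w.
Proof.
move=> r r' e; have [D _ cD] : exists2 D : {set 'I_m}, set0 \subset D & #|D| = s.
  by apply: superset_of_card; rewrite ?cards0 // card_ord.
by apply: (strength_eq cD) => u _; rewrite e.
Qed.

(** Extend U to an s-set D. By strength, restriction to D is a bijection from the rows onto the
    words on D, so the coordinates count independently: [q] letters on U, [q.+1] on the rest of
    D. *)
Lemma card_avoid (U : {set 'I_m}) (b : word) : #|U| <= s ->
  #|[set r | [forall u in U, w r u != b u]]| = q ^ #|U| * q.+1 ^ (s - #|U|).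
Proof.
move=> hU; have [D UD cD] : exists2 D : {set 'I_m}, U \subset D & #|D| = s.
  by apply: superset_of_card; rewrite // card_ord.
(* Filling in [b] off D represents a word on D by a full word. *)
pose rest r : word := [ffun u => if u \in D then w r u else b u].
pose F u : pred 'I_q.+1 :=
  if u \in U then predC1 (b u) else if u \in D then predT else pred1 (b u).
have rest_inj : injective rest.
  move=> r r' /ffunP e; apply: (strength_eq cD) => u uD.
  by have := e u; rewrite !ffunE uD.
transitivity #|family F : pred word|.
  rewrite -(card_imset _ rest_inj); apply: eq_card => v; apply/imsetP/familyP.
    case=> r; rewrite inE => /forall_inP hr -> u; rewrite /F ffunE.
    case: (boolP (u \in U)) => [uU|_]; first by rewrite (subsetP UD) // inE hr.
    by case: ifP => _; rewrite inE.
  move=> hv; have [r [hr _]] := hw v cD; exists r; last first.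
    apply/ffunP => u; rewrite ffunE; case: ifP => [/hr //|uD].
    have := hv u; rewrite /F uD ifN ?inE; first by move/eqP.
    by apply: contraFN uD; apply: subsetP.
  rewrite inE; apply/forall_inP => u uU; rewrite hr ?(subsetP UD) //.
  by have := hv u; rewrite /F uU.
rewrite card_words.
transitivity (\prod_u ((if u \in U then q else 1) *
                       (if u \in D :\: U then q.+1 else 1))).
  apply: eq_bigr => u _; rewrite /F !inE; case: ifP => uU /=.
    by rewrite muln1 cardC1 card_ord.
  by rewrite mul1n; case: ifP => _; rewrite ?card1 // cardT size_enum_ord.
rewrite big_split /= !prod_if_in !exp1n !muln1; congr (_ * _ ^ _).
by rewrite cardsD (setIidPr UD) cD.
Qed.

Lemma card_code : #|R| = q.+1 ^ s.
Proof.
have := @card_avoid set0 [ffun=> ord0]; rewrite cards0 => /(_ isT).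
rewrite mul1n subn0 => <-; rewrite -cardsT; apply: eq_card => r; rewrite !inE.
by apply/esym/forall_inP => u; rewrite inE.
Qed.

End Code.

Section ConstantSum.

Local Open Scope ring_scope.

(** A set of m - 1 coordinates misses a single one, whose letter is forced by the prescribed sum. *)
Lemma constant_sum_strength (a : 'I_q.+1) : (0 < m)%N ->
  strength m.-1 (val : {v : word | \sum_u v u == a} -> word).
Proof.
move=> m0 D v cD; have [x xD] : exists x, ~: D = [set x].
  apply/cards1P; rewrite cardsCs setCK cD card_ord.
  by rewrite -[X in (X - _)%N](prednK m0) subSnn.
have inD u : (u \in D) = (u != x).
  by rewrite -[D]setCK xD !inE.
have sumD (z : word) : \sum_u z u = z x + \sum_(u in D) z u.
  by rewrite (bigD1 x) //=; congr (_ + _); apply: eq_bigl => u; rewrite inD.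
pose z : word := [ffun u => if u \in D then v u else a - \sum_(u in D) v u].
have zD : {in D, z =1 v} by move=> u uD; rewrite ffunE uD.
have zP : \sum_u z u == a.
  by rewrite sumD (eq_bigr v) // ffunE inD eqxx /= subrK.
exists (Sub z zP); split=> [u uD|z' hz']; first exact: zD.
apply: val_inj; apply/ffunP => u; rewrite SubK ffunE; case: ifP => [/hz' //|].
rewrite inD => /negbFE/eqP ->; apply/eqP; rewrite subr_eq.
have <- : \sum_(i in D) val z' i = \sum_(i in D) v i by apply: eq_bigr => i /hz'.
by rewrite -sumD eq_sym (valP z').
Qed.

Lemma card_constant_sum (a : 'I_q.+1) : (0 < m)%N ->
  #|[set v : word | \sum_u v u == a]| = (q.+1 ^ m.-1)%N.
Proof.
move=> m0; rewrite -(card_code (leq_pred m) (constant_sum_strength a m0)).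
by rewrite card_sig; apply: eq_card => v; rewrite !inE.
Qed.

End ConstantSum.

(* Block c is the partial word [b c] restricted to the coordinates [U c]. *)
Definition covering (t L : nat) (C : finType) (U : C -> {set 'I_m}) (b : C -> word) :=
  (forall c, #|U c| = L) /\
  forall (T : {set 'I_m}) (v : word), #|T| = t ->
    exists! c, T \subset U c /\ {in T, b c =1 v}.

(** Double counting of triples (c, T, v) with T a t-subset of [U c] and v equal to [b c] on T. Since
    v ranges over full words, both sides are first multiplied by [q.+1 ^ (m - t)]. *)
Lemma card_covering t L (C : finType) (U : C -> {set 'I_m}) (b : C -> word) :
  t <= m -> covering t L U b -> #|C| * 'C(L, t) = 'C(m, t) * q.+1 ^ t.
Proof.
move=> htm [hU hT]; apply/eqP; rewrite -(eqn_pmul2r (m := q.+1 ^ (m - t))) ?expn_gt0 //.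
rewrite -[X in _ == X]mulnA -expnD subnKC //; apply/eqP.
pose f c (T : {set 'I_m}) (v : word) := (T \subset U c) && [forall u in T, b c u == v u].
transitivity (\sum_c \sum_(T : {set 'I_m} | #|T| == t) \sum_v (f c T v : nat)).
  rewrite -mulnA -sum_nat_const; apply: eq_bigr => c _.
  rewrite -(hU c) -cards_draws -sum1_card big_distrl /= big_mkcond /=.
  rewrite [RHS]big_mkcond /=; apply: eq_bigr => T _; rewrite inE /f.
  case: eqP => [cT|_]; last by rewrite andbF.
  rewrite andbT; case: ifP => _ /=; last by rewrite big1.
  rewrite mul1n -cT -(card_agree T (b c)) -sum1_card big_mkcond /=.
  by apply: eq_bigr => v _; rewrite inE; case: ifP.
rewrite exchange_big /=; under eq_bigr do rewrite exchange_big /=.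
have <- : #|{: word}| = q.+1 ^ m by rewrite card_ffun !card_ord.
rewrite -[X in 'C(X, t)]card_ord -card_draws -sum_nat_const.
rewrite [RHS](eq_bigl (fun T : {set 'I_m} => #|T| == t)).
  apply: eq_bigr => T /eqP cT; rewrite -sum1_card; apply: eq_bigr => v _.
  rewrite -(@card_unique _ [set c | f c T v]).
    rewrite -sum1_card [RHS]big_mkcond /=; apply: eq_bigr => c _.
    by rewrite inE; case: (f c T v).
  have [c [[Tc bc] hc]] := hT T v cT; exists c; split=> [|c'].
    by rewrite inE /f Tc; apply/forall_inP => u /bc ->.
  rewrite inE => /andP[Tc' /forall_inP bc']; apply: hc; split=> // u /bc'.
  by move/eqP.
by move=> T; rewrite inE.
Qed.

End Words.

(** * The array built from a code and a covering *)

Definition overwrite m q (T : {set 'I_m}) (e f : {ffun 'I_m -> 'I_q.+1}) :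
    {ffun 'I_m -> 'I_q.+1} :=
  [ffun u => if u \in T then e u else f u].

Section Array.

Variables m q s t L : nat.
Local Notation word := {ffun 'I_m -> 'I_q.+1}.
Variables (R C Lab : finType) (w : R -> word).
Variables (U : C -> {set 'I_m}) (b : C -> word).
Variable x : R -> C -> {set 'I_m} -> Lab.
Hypotheses (hLs : L <= s) (hsm : s <= m).
Hypotheses (hw : strength s w) (hC : covering t L U b).

(** Rows must be indexed independently of the column, so a t-subset of [U c] is named by its
    position in an enumeration. *)
Definition tset c (i : nat) : {set 'I_m} :=
  nth set0 (enum [set T : {set 'I_m} | T \subset U c & #|T| == t]) i.

Let size_tsets c :
  size (enum [set T : {set 'I_m} | T \subset U c & #|T| == t]) = 'C(L, t).
Proof. by rewrite -cardE cards_draws hC.1. Qed.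

Lemma tsetP c (i : 'I_('C(L, t))) : tset c i \subset U c /\ #|tset c i| = t.
Proof.
have : tset c i \in [set T : {set 'I_m} | T \subset U c & #|T| == t].
  by rewrite -mem_enum mem_nth // size_tsets.
by rewrite inE => /andP[-> /eqP].
Qed.

Lemma tset_inj c (i j : 'I_('C(L, t))) : tset c i = tset c j -> i = j.
Proof.
move=> /eqP; rewrite nth_uniq ?size_tsets ?enum_uniq // => /eqP.
exact: val_inj.
Qed.

Lemma tset_onto c (T : {set 'I_m}) : T \subset U c -> #|T| = t ->
  exists i : 'I_('C(L, t)), tset c i = T.
Proof.
move=> TU cT; set A := enum [set T : {set 'I_m} | T \subset U c & #|T| == t].
have TA : T \in A by rewrite mem_enum inE TU cT eqxx.
have lt : index T A < 'C(L, t) by rewrite -(size_tsets c) index_mem.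
by exists (Ordinal lt); rewrite /tset nth_index.
Qed.

(* Overwriting alone need not determine the row; the label x is what is recorded
   in addition so that it does. *)
Definition entry (j : R * 'I_('C(L, t))) c : option (Lab * word) :=
  if [forall u in U c, w j.1 u != b c u]
  then Some (x j.1 c (tset c j.2), overwrite (tset c j.2) (b c) (w j.1))
  else None.

Lemma entryP j c a : entry j c = Some a ->
  [/\ {in U c, forall u, w j.1 u != b c u}, a.1 = x j.1 c (tset c j.2)
    & a.2 = overwrite (tset c j.2) (b c) (w j.1)].
Proof. by rewrite /entry; case: forall_inP => // h [<-]. Qed.

Lemma covering_eq (T : {set 'I_m}) c c' : #|T| = t ->
  T \subset U c -> T \subset U c' -> {in T, b c =1 b c'} -> c = c'.
Proof.
move=> cT Tc Tc' e; have [c0 [_ h]] := hC.2 T (b c') cT.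
by rewrite -(h c) ?(h c').
Qed.

(** Whether a cell is starred depends on the codeword only, not on the t-subset. *)
Lemma entry_C1 c : #|[set j | entry j c == None]| =
  (q.+1 ^ s - q ^ L * q.+1 ^ (s - L)) * 'C(L, t).
Proof.
have -> : [set j | entry j c == None] =
    setX (~: [set r | [forall u in U c, w r u != b c u]]) [set: 'I_('C(L, t))].
  by apply/setP => j; rewrite !inE andbT /entry; case: ifP.
rewrite cardsX cardsT card_ord cardsCs setCK (card_code hsm hw).
by rewrite (card_avoid hsm hw) ?hC.1.
Qed.

Hypothesis hx : forall r r' c (T : {set 'I_m}), T \subset U c -> #|T| = t ->
  x r c T = x r' c T -> overwrite T (b c) (w r) = overwrite T (b c) (w r') -> r = r'.

(* If the t-sets of two entries with the same symbol differ, the overwritten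
   word agrees with block c1 at some u outside the second t-set, where it still
   equals the row of the second entry. *)
Lemma entry_C3 a j1 c1 j2 c2 : entry j1 c1 = Some a -> entry j2 c2 = Some a ->
  (j1, c1) = (j2, c2) \/ entry j1 c2 = None.
Proof.
move=> /entryP[n1 l1 e1] /entryP[n2 l2 e2].
have [s1 k1] := tsetP c1 j1.2; have [s2 k2] := tsetP c2 j2.2.
have [eT|neT] := eqVneq (tset c2 j2.2) (tset c1 j1.2).
  have ec : c1 = c2.
    apply: (covering_eq k1) => //; first by rewrite -eT.
    move=> u uT; move/ffunP/(_ u): (etrans (esym e1) e2).
    by rewrite !ffunE eT uT.
  subst c2; left; rewrite eT in l2 e2.
  have er : j1.1 = j2.1.
    exact: (hx s1 k1 (etrans (esym l1) l2) (etrans (esym e1) e2)).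
  by congr (_, _); apply: injective_projections er (esym (tset_inj eT)).
right; have /subsetPn[u u2 u1] : ~~ (tset c2 j2.2 \subset tset c1 j1.2).
  by apply/negP => h; case/negP: neT; rewrite eqEcard h k1 k2 /=.
rewrite /entry; case: forall_inP => // /(_ u (subsetP s2 _ u2)) /negP[].
move/ffunP/(_ u): (etrans (esym e1) e2).
by rewrite !ffunE u2 (negPf u1) => ->.
Qed.

Lemma entry_pda K : #|C| = K ->
  exists P : 'M[option 'I_#|attained entry|]_(q.+1 ^ s * 'C(L, t), K),
    is_pda ((q.+1 ^ s - q ^ L * q.+1 ^ (s - L)) * 'C(L, t)) P.
Proof.
move=> cC; apply: pda_of_array cC entry_C1 entry_C3.
by rewrite card_prod card_ord (card_code hsm hw).
Qed.

(** Source of the attained symbols in both exact counts. The block agreeing with e on the difference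
    set D satisfies [U c = D] by cardinality, as L = t, and overwriting the row on D turns it into
    e. *)
Lemma entry_full r (e : word) : L = t -> #|[set u | w r u != e u]| = t ->
  exists c i, [/\ U c = [set u | w r u != e u], {in U c, b c =1 e}
    & entry (r, i) c = Some (x r c (U c), e)].
Proof.
set D := [set u | _] => eL cD; have [c [[DU bD] _]] := hC.2 D e cD.
have eU : D = U c by apply/eqP; rewrite eqEcard DU hC.1 cD eL /=.
have [i ei] := tset_onto DU cD; exists c, i; split=> //; first by rewrite -eU.
rewrite /entry /= ei; case: forall_inP => [_|[]]; last first.
  by move=> u; rewrite -eU => uD; rewrite bD //; move: uD; rewrite inE.
congr (Some (x r c _, _)) => //; apply/ffunP => u; rewrite ffunE.
by case: ifP => [/bD //|]; rewrite inE => /negbFE/eqP.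
Qed.

End Array.

(** * Symbols labelled by differences *)

Section Differences.

Local Open Scope ring_scope.

Variables m q s t L : nat.
Local Notation word := {ffun 'I_m -> 'I_q.+1}.
Variables (R C : finType) (w : R -> word).
Variables (U : C -> {set 'I_m}) (b : C -> word) (u0 : 'I_m).
Hypothesis hsm : (s <= m)%N.
Hypotheses (hw : strength s w) (hC : covering t L U b).

(** Indexing by position in [enum T] gives the labels of all t-sets a common type; the default [u0]
    is not reached when |T| = t. *)
Definition diffs (r : R) (c : C) (T : {set 'I_m}) : {ffun 'I_t -> 'I_q.+1} :=
  [ffun i : 'I_t => w r (nth u0 (enum T) i) - b c (nth u0 (enum T) i)].

Let nth_tset (T : {set 'I_m}) u : #|T| = t -> u \in T ->
  exists i : 'I_t, nth u0 (enum T) i = u.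
Proof.
move=> cT uT; have lt : (index u (enum T) < t)%N by rewrite -cT cardE index_mem mem_enum.
by exists (Ordinal lt); rewrite nth_index ?mem_enum.
Qed.

Let mem_tset (T : {set 'I_m}) (i : 'I_t) : #|T| = t -> nth u0 (enum T) i \in T.
Proof. by move=> cT; rewrite -mem_enum mem_nth // -cardE cT. Qed.

Lemma sum_nth_tset (T : {set 'I_m}) (g : 'I_m -> 'I_q.+1) : #|T| = t ->
  \sum_(i < t) g (nth u0 (enum T) i) = \sum_(u in T) g u.
Proof.
by move=> cT; rewrite -[RHS]big_enum [RHS](big_nth u0) big_mkord -cardE cT.
Qed.

(** On T the row is the block plus the differences; off T it is the overwritten word. *)
Lemma diffs_inj r r' c (T : {set 'I_m}) : T \subset U c -> #|T| = t ->
  diffs r c T = diffs r' c T ->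
  overwrite T (b c) (w r) = overwrite T (b c) (w r') -> r = r'.
Proof.
move=> _ cT /ffunP ed /ffunP eo; apply: (strength_inj hsm hw); apply/ffunP => u.
case: (boolP (u \in T)) => uT; last by have := eo u; rewrite !ffunE (negPf uT).
by have [i <-] := nth_tset cT uT; have := ed i; rewrite !ffunE => /addIr.
Qed.

Lemma card_nowhere0 :
  #|[set y : {ffun 'I_t -> 'I_q.+1} | [forall i, y i != 0]]| = (q ^ t)%N.
Proof.
have <- : #|ffun_on (predC1 (0 : 'I_q.+1)) : pred {ffun 'I_t -> 'I_q.+1}| = (q ^ t)%N.
  by rewrite card_ffun_on cardC1 !card_ord.
apply: eq_card => y; rewrite inE; apply/forallP/ffun_onP => h i.
  by rewrite inE h.
by have := h i; rewrite inE.
Qed.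

Lemma diffs_nowhere0 r c (T : {set 'I_m}) : #|T| = t -> T \subset U c ->
  {in U c, forall u, w r u != b c u} -> [forall i, diffs r c T i != 0].
Proof.
move=> cT TU h; apply/forallP => i; rewrite ffunE subr_eq0 h //.
exact: (subsetP TU) (mem_tset i cT).
Qed.

(** At an unstarred cell the row avoids the block, so only the [q ^ t] nowhere-zero labels occur. *)
Lemma card_attained_diffs :
  (#|attained (entry (t := t) (L := L) w U b diffs)| <= q ^ t * q.+1 ^ m)%N.
Proof.
have <- : #|{: word}| = (q.+1 ^ m)%N by rewrite card_ffun !card_ord.
rewrite -card_nowhere0 -cardsT -cardsX; apply/subset_leq_card/subsetP => a.
case/attainedP => j [c /entryP[h e _]]; rewrite !inE e andbT.
have [TU cT] := tsetP hC c j.2.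
exact: diffs_nowhere0.
Qed.

(** Overwriting a zero-sum row lowers its sum by the sum of the differences. Conversely, adding y to
    e along any t-set D gives a zero-sum word, hence a row, and it differs from e exactly on D
    because y is nowhere zero. *)
Lemma attained_zero_sum (y : {ffun 'I_t -> 'I_q.+1}) (e : word) :
  L = t -> (t <= m)%N ->
  (forall v, (exists r, w r = v) <-> \sum_u v u = 0) ->
  (y, e) \in attained (entry (t := t) (L := L) w U b diffs) =
  [forall i, y i != 0] && (\sum_u e u == - \sum_i y i).
Proof.
move=> eL htm h0; apply/attainedP/idP => [[j [c jc]]|/andP[/forallP y0 /eqP sy]].
  have [h /= -> ->] := entryP jc; have [TU cT] := tsetP hC c j.2.
  rewrite diffs_nowhere0 //=; set T := tset _ _ _ _ in TU cT *.
  have -> : \sum_i diffs j.1 c T i = \sum_(u in T) (w j.1 u - b c u).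
    by rewrite -(sum_nth_tset _ cT); apply: eq_bigr => i _; rewrite ffunE.
  have w0 : \sum_u w j.1 u = 0 by apply/h0; exists j.1.
  rewrite -subr_eq0 opprK [X in _ + X]big_mkcond /= -big_split /= -[X in _ == X]w0.
  apply/eqP/eq_bigr => u _; rewrite ffunE; case: ifP => _; last by rewrite addr0.
  by rewrite addrC subrK.
have [D _ cD] : exists2 D : {set 'I_m}, set0 \subset D & #|D| = t.
  by apply: superset_of_card; rewrite ?cards0 // card_ord.
(* This spreads y along D. Outside D the index is t, where [insub] fails, and the value is 0. *)
pose yD u : 'I_q.+1 :=
  if insub (index u (enum D)) : option 'I_t is Some i then y i else 0.
have yD_nth (i : 'I_t) : yD (nth u0 (enum D) i) = y i.
  rewrite /yD index_uniq ?enum_uniq -?cardE ?cD // insubT //= => lt.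
  by congr (y _); apply: val_inj.
have yD_out u : u \notin D -> yD u = 0.
  move=> uD; rewrite /yD insubF //; apply/negbTE; rewrite -leqNgt -{1}cD cardE.
  by rewrite leqNgt index_mem mem_enum.
have [r er] : exists r, w r = [ffun u => e u + yD u].
  apply/h0; under eq_bigr do rewrite ffunE.
  rewrite big_split /= sy [X in _ + X](bigID (mem D)) /=.
  rewrite [X in _ + (_ + X)]big1 // addr0 -(sum_nth_tset _ cD).
  by rewrite [X in _ + X](eq_bigr y) => [|i _ //]; rewrite addNr.
have eD : [set u | w r u != e u] = D.
  apply/setP => u; rewrite inE er ffunE -subr_eq0 addrAC subrr add0r.
  case: (boolP (u \in D)) => [uD|/yD_out ->]; last by rewrite eqxx.
  by have [i <-] := nth_tset cD uD; rewrite yD_nth y0.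
have cwe : #|[set u | w r u != e u]| = t by rewrite eD.
have [c [i [eU be re]]] := entry_full diffs hC eL cwe.
exists (r, i), c; rewrite re; congr (Some (_, _)); apply/ffunP => k.
rewrite eU eD in be *; have kD := mem_tset k cD.
by rewrite ffunE (be _ kD) er ffunE addrAC subrr add0r yD_nth.
Qed.

Lemma card_attained_zero_sum : (0 < m)%N -> L = t -> (t <= m)%N ->
  (forall v, (exists r, w r = v) <-> \sum_u v u = 0) ->
  #|attained (entry (t := t) (L := L) w U b diffs)| = (q ^ t * q.+1 ^ m.-1)%N.
Proof.
move=> m0 eL htm h0; rewrite -card_nowhere0 -sum_nat_const -sum1_card.
under [RHS]eq_bigr => y _ do
  rewrite -(card_constant_sum (- \sum_i y i) m0) -sum1_card.
rewrite pair_big_dep /=; apply: eq_bigl => -[y e] /=.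
by rewrite attained_zero_sum // !inE.
Qed.

End Differences.

(** * Symbols consisting of the overwritten word alone *)

Section NonCodewords.

Variables m q s t : nat.
Local Notation word := {ffun 'I_m -> 'I_q.+1}.
Variables (R C : finType) (w : R -> word).
Variables (U : C -> {set 'I_m}) (b : C -> word).
Hypotheses (ht : 0 < t) (hst : s + t = m) (hts : t < s).
Hypotheses (hw : strength s w) (hC : covering t t U b).

Let no_label (r : R) (c : C) (T : {set 'I_m}) := tt.

Let hsm : s <= m. Proof. by rewrite -hst leq_addr. Qed.

Let card_compl (T : {set 'I_m}) : #|T| = t -> #|~: T| = s.
Proof. by move=> cT; rewrite cardsCs setCK cT card_ord -hst addnK. Qed.

(** The s coordinates off T survive overwriting and determine the codeword. *)
Lemma overwrite_codeword_inj r r' c (T : {set 'I_m}) : T \subset U c -> #|T| = t ->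
  no_label r c T = no_label r' c T ->
  overwrite T (b c) (w r) = overwrite T (b c) (w r') -> r = r'.
Proof.
move=> _ /card_compl cT _ /ffunP e; apply: (strength_eq hw cT) => u.
by rewrite inE => uT; have := e u; rewrite !ffunE (negPf uT).
Qed.

(* By the strength of w, every t-set contains the difference set of exactly one
   codeword. *)
Lemma noncodeword_dist_t (e : word) : (forall r, w r != e) ->
  exists r, #|[set u | w r u != e u]| = t.
Proof.
move=> he; pose D r := [set u | w r u != e u].
have [||T cT|_ /imsetP[r _ ->]] := @exists_member_of_card _ t (D @: setT).
(* The size condition 2t <= m + 1 comes from [t < s]. *)
- by rewrite card_ord -hst -addnn; lia.
(* An empty difference set would make e a codeword. *)
- apply/imsetP => -[r _ /setP e0]; case/eqP: (he r); apply/ffunP => u.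
  by have := e0 u; rewrite !inE => /esym/negbFE/eqP.
- have [r [hr hr']] := hw e (card_compl cT); exists (D r); split.
    split; first by rewrite imset_f.
    apply/subsetP => u; rewrite inE; apply: contraNT => uT.
    by rewrite hr // inE.
  move=> _ [/imsetP[r' _ ->] /subsetP DT]; rewrite (hr' r') // => u.
  by rewrite inE => uT; apply/eqP; apply: contraNT uT => uD; rewrite DT // inE.
by exists r.
Qed.

(** An attained codeword would agree with its row on the s coordinates off T, hence equal it; but
    the row avoids the block on T, which is nonempty. Conversely, a row at distance t from e yields
    e by [entry_full]. *)
Lemma attained_no_label :
  attained (entry (t := t) (L := t) w U b no_label) = [set a | a.2 \notin codom w].
Proof.
apply/setP => -[[] e]; rewrite inE /=; apply/attainedP/idP.
  move=> [j [c /entryP[h _ /= ->]]]; have [TU cT] := tsetP hC c j.2.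
  apply/codomP => -[r er].
  have ej : j.1 = r.
    apply: (strength_eq hw (card_compl cT)) => u; rewrite inE => uT.
    by rewrite -er ffunE (negPf uT).
  have /card_gt0P[u uT] : 0 < #|tset t U c j.2| by rewrite cT.
  have := h _ (subsetP TU _ uT).
  by rewrite ej -er ffunE uT eqxx.
move=> he; have [|r cr] := @noncodeword_dist_t e.
  by move=> r; apply: contraNneq he => <-; apply: codom_f.
have [c [i [_ _ re]]] := entry_full no_label hC (erefl t) cr.
by exists (r, i), c.
Qed.

Lemma card_attained_no_label :
  #|attained (entry (t := t) (L := t) w U b no_label)| = (q.+1 ^ t - 1) * q.+1 ^ (m - t).
Proof.
have -> : m - t = s by rewrite -hst addnK.
rewrite attained_no_label mulnBl mul1n -expnD addnC hst.
have -> : [set a : unit * word | a.2 \notin codom w] = setX setT (~: [set v in codom w]).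
  by apply/setP => a; rewrite !inE.
rewrite cardsX cardsT card_unit mul1n cardsCs setCK cardsE.
rewrite (card_codom (strength_inj hsm hw)) (card_code hsm hw).
by rewrite card_ffun !card_ord.
Qed.

End NonCodewords.

(** * Coverings from GDDs and codes from orthogonal arrays *)

Lemma count_tnth (T : eqType) (p : pred T) (B : seq T) :
  count p B = #|[set c : 'I_(size B) | p (tnth (in_tuple B) c)]|.
Proof.
rewrite -sum1_count big_tnth -sum1_card; apply: eq_bigl => c.
by rewrite inE.
Qed.

(** Groups become coordinates and the points of a group become letters; a block meets each group at
    most once, so it is a partial word. Columns are positions in [B], in accordance with
    multiplicities. *)
Lemma covering_of_gdd (t m q L : nat) (X : finType) (G : {set {set X}})
    (B : seq {set X}) : 0 < m -> is_gdd t m q.+1 L 1 G B ->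
  exists (U : 'I_(size B) -> {set 'I_m}) (b : 'I_(size B) -> {ffun 'I_m -> 'I_q.+1}),
    covering t L U b.
Proof.
move=> m0 [hX /and3P[/eqP hcov htriv _] hm hg hL hBg hT].
have [x0 _] : exists x0, x0 \in X by apply/card_gt0P; rewrite hX muln_gt0 m0.
pose gr (u : 'I_m) := nth set0 (enum G) u.
have grG u : gr u \in G by rewrite -mem_enum mem_nth // -cardE hm.
have gr_inj u u' : gr u = gr u' -> u = u'.
  by move/eqP; rewrite nth_uniq ?enum_uniq -?cardE ?hm // => /eqP/val_inj.
have gr_eq g x u : g \in G -> x \in g -> x \in gr u -> g = gr u.
  move=> gG xg xu; apply/eqP/negPn/negP => ne.
  have /pred0P/(_ x) := trivIsetP htriv _ _ gG (grG u) ne.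
  by rewrite /= xg xu.
pose pt u (a : 'I_q.+1) := nth x0 (enum (gr u)) a.
have pt_gr u a : pt u a \in gr u by rewrite -mem_enum mem_nth // -cardE hg.
have pt_inj u u' a a' : pt u a = pt u' a' -> u = u' /\ a = a'.
  move=> e; have eu : u = u'.
    by apply/gr_inj/(@gr_eq _ (pt u a)); rewrite ?pt_gr // e pt_gr.
  split=> //; move/eqP: e; rewrite -eu nth_uniq ?enum_uniq -?cardE ?hg //.
  by move/eqP/val_inj.
have pt_onto x : exists u a, x = pt u a.
  have : x \in cover G by rewrite hcov inE.
  case/bigcupP => g gG xg.
  have lu : index g (enum G) < m by rewrite -hm cardE index_mem mem_enum.
  have eg : gr (Ordinal lu) = g by rewrite /gr nth_index ?mem_enum.
  have la : index x (enum g) < q.+1 by rewrite -(hg g gG) cardE index_mem mem_enum.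
  by exists (Ordinal lu), (Ordinal la); rewrite /pt eg nth_index ?mem_enum.
pose Bl c := tnth (in_tuple B) c.
have BlB c : Bl c \in B by rewrite mem_tnth.
have Bl_uniq c u a a' : pt u a \in Bl c -> pt u a' \in Bl c -> a = a'.
  move=> h h'; have /card_le1_eqP/(_ (pt u a) (pt u a')) := hBg _ _ (BlB c) (grG u).
  by rewrite !inE h h' !pt_gr => /(_ isT isT) /pt_inj[].
pose U c := [set u | [exists a, pt u a \in Bl c]].
(* The letter [ord0] off [U c] is arbitrary: [covering] reads [b c] only on subsets of [U c]. *)
pose b c : {ffun 'I_m -> 'I_q.+1} :=
  [ffun u => odflt ord0 [pick a | pt u a \in Bl c]].
have UE c u a : pt u a \in Bl c -> u \in U c /\ b c u = a.
  move=> h; split; first by rewrite inE; apply/existsP; exists a.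
  rewrite ffunE; case: pickP => [a' h'|/(_ a)]; last by rewrite h.
  exact: (Bl_uniq c u _ _ h' h).
have Ub c u : u \in U c -> pt u (b c u) \in Bl c.
  by rewrite inE => /existsP[a h]; have [_ ->] := UE _ _ _ h.
exists U, b; split=> [c|T v cT].
  rewrite -(hL _ (BlB c)).
  rewrite -(card_in_imset (f := fun u => pt u (b c u))); last first.
    by move=> u u' _ _ /pt_inj[].
  apply: eq_card => x; apply/imsetP/idP => [[u /Ub h -> //]|].
  have [u [a ->]] := pt_onto x => h; have [uU e] := UE _ _ _ h.
  by exists u; rewrite ?e.
(* The word v on T becomes a t-set of points from distinct groups, which lies in exactly one
   block. *)
pose T' := [set pt u (v u) | u in T].
have cT' : #|T'| = t by rewrite card_imset // => u u' /pt_inj[].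
have tT' g : g \in G -> #|T' :&: g| <= 1.
  move=> gG; apply/card_le1_eqP => x y; rewrite !inE.
  move=> /andP[/imsetP[u _ ->] xg] /andP[/imsetP[u' _ ->] yg].
  suff -> : u = u' by [].
  by apply: gr_inj; rewrite -(gr_eq _ _ _ gG xg (pt_gr _ _))
    (gr_eq _ _ _ gG yg (pt_gr _ _)).
have T'P c : reflect (T \subset U c /\ {in T, b c =1 v}) (T' \subset Bl c).
  apply: (iffP subsetP) => [h|[TU bv] _ /imsetP[u uT ->]].
    have h' u : u \in T -> u \in U c /\ b c u = v u.
      by move=> uT; apply/UE/h/imset_f.
    by split=> [|u /h'[]//]; apply/subsetP => u /h'[].
  by rewrite -bv // Ub // (subsetP TU).
have /eqP/cards1P[c hc] : #|[set c | T' \subset Bl c]| = 1.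
  by rewrite -[RHS](hT _ cT' tT') count_tnth.
exists c; split.
  by apply/T'P; have := set11 c; rewrite -hc inE.
by move=> c' /T'P h; apply/eqP; rewrite eq_sym -in_set1 -hc inE.
Qed.

(** The injective choice of columns is an enumeration of D. *)
Lemma strength_of_oa (m q s : nat) (A : 'M['I_q.+1]_(1 * q.+1 ^ s, m)) :
  is_oa A -> strength s (fun r => [ffun u => A r u]).
Proof.
move=> hA D v cD.
pose c (i : 'I_s) : 'I_m := enum_val (cast_ord (esym cD) i).
have c_inj : injective c by move=> i j /enum_val_inj/cast_ord_inj.
have /eqP/cards1P[r hr] := hA c [ffun i => v (c i)] c_inj.
have rP r' : reflect {in D, [ffun u => A r' u] =1 v} (r' == r).
  rewrite -in_set1 -hr inE; apply: (iffP forallP) => h.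
    move=> u uD; have := h (cast_ord cD (enum_rank_in uD u)).
    by rewrite !ffunE /c cast_ordK enum_rankK_in // => /eqP.
  move=> i; have := h (c i); rewrite !ffunE => -> //.
  exact: enum_valP.
exists r; split; first exact/rP.
by move=> r' /rP/eqP.
Qed.

(** * Arithmetic of memory and load *)

Section Loads.

Local Open Scope ring_scope.

Lemma natrS_sub1 (q : nat) : q.+1%:R - 1 = q%:R :> rat.
Proof. by rewrite -natr1 addrK. Qed.

Lemma leq_expr_succ (q L s : nat) : (L <= s)%N -> (q ^ L * q.+1 ^ (s - L) <= q.+1 ^ s)%N.
Proof.
move=> hLs; rewrite -[in leqRHS](subnKC hLs) expnD leq_mul2r; apply/orP; right.
by case: L {hLs} => // L; rewrite leq_exp2r.
Qed.

(** The natural subtraction is not truncated, by [leq_expr_succ]; splitting [q.+1 ^ s] at exponent L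
    leaves a field identity. *)
Lemma cached_packets (q L s c N : nat) : (L <= s)%N ->
  (N * ((q.+1 ^ s - q ^ L * q.+1 ^ (s - L)) * c))%:R =
  (N%:R - (q.+1%:R - 1) ^+ L * N%:R / q.+1%:R ^+ L) * (q.+1 ^ s * c)%:R :> rat.
Proof.
move=> hLs; rewrite !natrM natrB ?leq_expr_succ // natrM !natrX.
rewrite -{1 3}(subnKC hLs) exprD natrS_sub1.
have : q.+1%:R ^+ L != 0 :> rat by rewrite expf_neq0 ?pnatr_eq0.
by move: (q.+1%:R ^+ L) (q.+1%:R ^+ (s - L)) => x y hx; field.
Qed.

Lemma load_bound (q t m s c S : nat) : (s <= m)%N -> (S <= q ^ t * q.+1 ^ m)%N ->
  S%:R / (q.+1 ^ s * c)%:R <= (q.+1%:R - 1) ^+ t * q.+1%:R ^+ (m - s) / c%:R :> rat.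
Proof.
(* For c = 0 both sides vanish, the inverse of 0 being 0. *)
move=> hsm hS; have [->|c0] := posnP c; first by rewrite muln0 invr0 !mulr0.
have Q0 : 0 < q.+1%:R ^+ s :> rat by rewrite exprn_gt0 ?ltr0n.
rewrite natrS_sub1 natrM natrX invfM mulrA ler_pM2r ?invr_gt0 ?ltr0n //.
rewrite ler_pdivrMr // -mulrA -exprD subnK //.
by move: hS; rewrite -(ler_nat rat) natrM !natrX.
Qed.

End Loads.

Theorem corollary2 (t L s m q : nat)
    (ht : 0 < t) (htL : t <= L) (hLs : L <= s) (hsm : s <= m) (hq : 2 <= q)
    (hgdd : exists (X : finType) (G : {set {set X}}) (B : seq {set X}),
        is_gdd t m q L 1 G B)
    (hoa : exists A : 'M['I_q]_(1 * q ^ s, m), is_oa A) :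
  let K := ('C(m, t) * q ^ t) %/ 'C(L, t) in
  let F := q ^ s * 'C(L, t) in
  let Z := (q ^ s - (q - 1) ^ L * q ^ (s - L)) * 'C(L, t) in
  let M := fun N : nat =>
    (N%:R - (q%:R - 1) ^+ L * N%:R / q%:R ^+ L : rat)%R in
  [/\ (* the quotient defining K is exact *)
      'C(L, t) %| 'C(m, t) * q ^ t,
      exists (S : nat) (P : 'M[option 'I_S]_(F, K)),
        is_pda Z P /\ S <= (q - 1) ^ t * q ^ m
    & forall N : nat, K <= N ->
        achievable N K F (M N)
          ((q%:R - 1) ^+ t * q%:R ^+ (m - s) / ('C(L, t))%:R)%R]
  /\
  [/\ L = t -> s = m - 1 ->
        exists (S : nat) (P : 'M[option 'I_S]_(F, K)),
          [/\ is_pda Z P, S = (q - 1) ^ t * q ^ (m - 1),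
              (S%:R / F%:R = (q%:R - 1) ^+ t :> rat)%R & pda_scheme P M],
      L = t -> s + t = m -> t < s ->
        exists (S : nat) (P : 'M[option 'I_S]_(F, K)),
          [/\ is_pda Z P, S = (q ^ t - 1) * q ^ (m - t),
              (S%:R / F%:R = q%:R ^+ t - 1 :> rat)%R & pda_scheme P M]
    & s = m ->
        exists (S : nat) (P : 'M[option 'I_S]_(F, K)),
          [/\ is_pda Z P, S <= (q - 1) ^ t * q ^ m,
              (S%:R / F%:R <= (q%:R - 1) ^+ t / ('C(L, t))%:R :> rat)%R
            & pda_scheme P M]].
Proof.
(* Writing q as a successor gives the letters the additive structure of the integers modulo q. *)
case: q hq hgdd hoa => // q _ [X [G [B hG]]] [A hA].
have q1 : q.+1 - 1 = q by rewrite subn1.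
move=> K F Z M; rewrite q1.
have eZ : Z = (q.+1 ^ s - q ^ L * q.+1 ^ (s - L)) * 'C(L, t) by rewrite /Z q1.
move: {Z} (Z) eZ => Z eZ.
have m0 : 0 < m by lia.
have htm : t <= m by lia.
have [U [b hC]] := covering_of_gdd m0 hG.
have cC := card_covering htm hC.
have C0 : 0 < 'C(L, t) by rewrite bin_gt0.
have cK : #|'I_(size B)| = K by rewrite /K -cC mulnK.
have hA' := strength_of_oa hA.
have sch S (P : 'M[option 'I_S]_(F, K)) : is_pda Z P -> pda_scheme P M.
  move=> hP N l hN; have [sc [h1 h2 h3]] := pda_scheme_exists l hP hN.
  by exists sc; split=> // k; rewrite h2 eZ /M /F cached_packets.
have [S [P [hP hS]]] : exists (S : nat) (P : 'M[option 'I_S]_(F, K)),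
    is_pda Z P /\ S <= q ^ t * q.+1 ^ m.
  have [P hP] := entry_pda hLs hsm hA' hC (diffs_inj (u0 := Ordinal m0) hsm hA') cK.
  by rewrite eZ; exists _, P; split=> //; apply: (card_attained_diffs _ _ hC).
split; split.
- by apply/dvdnP; exists (size B); rewrite -cC card_ord.
- by exists S, P.
- move=> N hN l; have [sc [_ h2 h3]] := sch _ _ hP N l hN; exists sc; split=> //.
  by rewrite h3 load_bound.
- move=> eL es; subst L.
  have es' : s = m.-1 by rewrite es subn1.
  (* The zero-sum words have strength m - 1 = s, as the given array does, so K, F and Z are
     unchanged. *)
  pose w := val : {v : {ffun 'I_m -> 'I_q.+1} | (\sum_u v u == 0)%R} ->
    {ffun 'I_m -> 'I_q.+1}.
  have hw : strength s w by rewrite es'; apply: constant_sum_strength.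
  have [P' hP'] := entry_pda hLs hsm hw hC (diffs_inj (u0 := Ordinal m0) hsm hw) cK.
  have w0 v : (exists r, w r = v) <-> (\sum_u v u = 0)%R.
    split=> [[r <-]|/eqP hv]; first exact/eqP/(valP r).
    by exists (Sub v hv); rewrite /w SubK.
  have cS := card_attained_zero_sum (Ordinal m0) hC m0 erefl htm w0.
  rewrite -eZ in hP'; exists _, P'; split=> //; first by rewrite cS subn1.
    rewrite cS /F es' binn muln1 natrM mulfK ?pnatr_eq0 ?expn_eq0 //.
    by rewrite natrX natrS_sub1.
  exact: sch.
- move=> eL hst hts; subst L.
  have [P' hP'] := entry_pda hLs hsm hA' hC (overwrite_codeword_inj hst hA') cK.
  have cS := card_attained_no_label ht hst hts hA' hC.
  rewrite -eZ in hP'; exists _, P'; split=> //.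
    rewrite cS /F binn muln1 -[X in X - t]hst addnK natrM mulfK ?pnatr_eq0 ?expn_eq0 //.
    by rewrite natrB ?expn_gt0 // natrX.
  exact: sch.
(* The general array serves, with exponent m - s = 0 in the load bound. *)
- move=> es; exists S, P; split=> //; last exact: sch.
  have := load_bound 'C(L, t) hsm hS.
  by rewrite -/F es subnn expr0 mulr1.
Qed.
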